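(* Fix $n\in\mathbb{Z}_{\ge1}$ and $k\in\mathbb{Z}_{\ge0}$. Let $e_0\mid e_1\mid\cdots\mid e_{r-1}\mid e_r$ with $r\ge1$, $e_r=n$ and $e_{r-1}=\gcd(n,k)$, and set $e=e_0$, $d=e_1$. Let $\mathcal{G}_D=\bigcap_{i=0}^{r-1}\mathcal{G}_{e_{i+1},e_i}$. Let $C_d$ act on $[0,n-1]$ by the permutation simultaneously cyclically rotating each $d$-interval $I_d^j$, and elementwise on subsets. Then $(\mathcal{G}_D,C_d,\mathcal{G}_D^{\mathrm{Sum}'}(q))$ exhibits the cyclic sieving phenomenon, and hence refines the CSP triple $(\mathcal{S},C_d,\mathcal{S}^{\mathrm{Sum}'}(q))$.
   Context: $[a,b]=\{i\in\mathbb{Z}:a\le i\le b\}$. $\mathcal{S}$ is the set of $k$-element subsets of $[0,n-1]$. For $c\mid n$ and $j\in[1,n/c]$, the $c$-interval is $I_c^j=[(j-1)c,jc-1]$; the simultaneous rotation of $c$-intervals is the permutation of $[0,n-1]$ sending $x\mapsto x+1$ for $x\in I_c^j$, $x\neq jc-1$, and $jc-1\mapsto(j-1)c$. For $f\mid c\mid n$, $\mathcal{G}_{c,f}=\{A\in\mathcal{S}:\gcd(c,\#(A\cap I_c^1),\dots,\#(A\cap I_c^{n/c}))=f\}$. $\mathrm{Sum}'(A)=\sum_{a\in A}a-\binom{k}{2}$, and $X^{\mathrm{Sum}'}(q)=\sum_{A\in X}q^{\mathrm{Sum}'(A)}$. For a finite set $W$ acted on by a cyclic group $C=\langle\tau\rangle$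 of order $s$ and $f(q)\in\mathbb{N}[q]$, $(W,C,f(q))$ exhibits the CSP if $\#\{x\in W:\tau^jx=x\}=f(\omega_s^j)$ for all $j\in\mathbb{Z}$, $\omega_s$ a fixed primitive $s$-th root of unity. *)

(* Defs.v *)
From HB Require Import structures.
From mathcomp Require Import all_boot all_order all_algebra all_fingroup.

Set Implicit Arguments.
Unset Strict Implicit.
Unset Printing Implicit Defensive.

Import GRing.Theory Num.Theory.

Local Open Scope ring_scope.

Definition expgz (gT : finGroupType) (x : gT) (j : int) : gT :=
  match j with
  | Posz m => (x ^+ m)%g
  | Negz m => (x ^- m.+1)%g
  end.

(* The value f(x) at x : F of a polynomial f in N[q]. *)
Definition eval_natpoly (F : numClosedFieldType) (f : {poly nat}) (x : F) : F :=
  (map_poly (fun m : nat => m%:R) f).[x].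

(* (W, <[tau]>, f) exhibits the cyclic sieving phenomenon, where <[tau]> is
   cyclic of order s and w is the chosen primitive s-th root of unity.  The
   action need not be faithful, so s is the order of tau as a group element
   and not the order of the permutation of W that tau induces. *)
Definition exhibits_csp (F : numClosedFieldType) (s : nat) (w : F)
    (gT : finGroupType) (T : finType) (to : {action gT &-> T}) (tau : gT)
    (W : {set T}) (f : {poly nat}) : Prop :=
  [/\ #[tau]%g = s,
      s.-primitive_root w,
      [acts <[tau]>%g, on W | to] &
      forall j : int,
        #|[set x in W | to x (expgz tau j) == x]|%:R = eval_natpoly f (w ^ j)].

(* X^stat(q) *)
Definition stat_poly (T : finType) (stat : T -> nat) (X : {set T}) :
    {poly nat} :=
  \sum_(x in X) 'X^(stat x).

(* (V, <[tau]>, V^stat(q)) refines (W, <[tau]>, W^stat(q)): both are CSP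
   triples, V is a subset of W, and V carries the restricted action. *)
Definition refines_csp (F : numClosedFieldType) (s : nat) (w : F)
    (gT : finGroupType) (T : finType) (to : {action gT &-> T}) (tau : gT)
    (stat : T -> nat) (V W : {set T}) : Prop :=
  [/\ V \subset W,
      exhibits_csp s w to tau V (stat_poly stat V) &
      exhibits_csp s w to tau W (stat_poly stat W)].

Section Subsets.

Local Open Scope nat_scope.

Variables n k : nat.

Definition ksubsets : {set {set 'I_n}} := [set A : {set 'I_n} | #|A| == k].

Definition interval (c j : nat) : {set 'I_n} :=
  [set x : 'I_n | (j - 1) * c <= x <= j * c - 1].

Definition Gset (c f : nat) : {set {set 'I_n}} :=
  [set A in ksubsets |
    gcdn c (\big[gcdn/0]_(1 <= j < (n %/ c).+1) #|A :&: interval c j|) == f].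

(* No truncation occurs for A in ksubsets: distinct elements of [0, n-1] sum
   to at least 0 + 1 + ... + (k - 1) = 'C(k, 2). *)
Definition Sum' (A : {set 'I_n}) : nat := \sum_(a in A) (a : nat) - 'C(k, 2).

End Subsets.

Section Rotation.

Local Open Scope nat_scope.

Variables n c : nat.

(* The simultaneous rotation of c-intervals.  When c does not divide n, the
   points outside I_c^1, ..., I_c^(n %/ c) are fixed, so that this is a
   permutation of [0, n-1] for every c. *)
Definition rot_nat (x : nat) : nat :=
  if x < n %/ c * c then (if c %| x.+1 then x.+1 - c else x.+1) else x.

Lemma rot_nat_out (x : nat) : n %/ c * c <= x -> rot_nat x = x.
Proof. by rewrite /rot_nat leqNgt => /negPf ->. Qed.

Lemma rot_nat_block (q x : nat) : q < n %/ c -> q * c <= x < q.+1 * c ->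
  rot_nat x = if x.+1 == q.+1 * c then q * c else x.+1.
Proof.
move=> ltq /andP[le_x lt_x].
have c_gt0 : 0 < c by case: c ltq => //; rewrite divn0.
rewrite /rot_nat (leq_trans lt_x) ?leq_mul2r ?ltq ?orbT //.
have -> : (c %| x.+1) = (x.+1 == q.+1 * c).
  apply/idP/eqP => [/dvdnP[m Em]|->]; last exact: dvdn_mull.
  have : m * c <= q.+1 * c by rewrite -Em.
  have : q * c < m * c by rewrite -Em.
  rewrite ltn_pmul2r // leq_pmul2r // => ltqm lemq.
  by rewrite Em; congr (_ * _); apply/eqP; rewrite eqn_leq lemq.
by case: eqP => // ->; rewrite mulSn addKn.
Qed.

Lemma rot_nat_block_mem (q x : nat) : q < n %/ c -> q * c <= x < q.+1 * c ->
  q * c <= rot_nat x < q.+1 * c.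
Proof.
move=> ltq xq; have c_gt0 : 0 < c by case: c ltq => //; rewrite divn0.
rewrite (rot_nat_block ltq xq); case/andP: xq => le_x lt_x.
case: eqP => [_|/eqP neq]; first by rewrite leqnn ltn_pmul2r /=.
by rewrite (leq_trans le_x) //= ltn_neqAle neq.
Qed.

Lemma block_of (x : nat) : x < n %/ c * c ->
  exists2 q, q < n %/ c & q * c <= x < q.+1 * c.
Proof.
move=> lt_x; have c_gt0 : 0 < c by case: c lt_x => //; rewrite muln0.
by exists (x %/ c); rewrite ?ltn_divLR // leq_divM ltn_ceil.
Qed.

Lemma rot_nat_lt (x : nat) : (rot_nat x < n %/ c * c) = (x < n %/ c * c).
Proof.
case: (ltnP x (n %/ c * c)) => [lt_x|ge_x].
  have [q ltq xq] := block_of lt_x.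
  have /andP[_ lt_rx] := rot_nat_block_mem ltq xq.
  by apply: leq_trans lt_rx _; rewrite leq_mul2r ltq orbT.
by rewrite rot_nat_out // ltnNge ge_x.
Qed.

Lemma rot_nat_ltn (x : 'I_n) : rot_nat x < n.
Proof.
case: (ltnP x (n %/ c * c)) => [lt_x|ge_x].
  by rewrite (leq_trans _ (leq_divM n c)) // rot_nat_lt.
by rewrite rot_nat_out.
Qed.

Lemma rot_nat_inj : injective rot_nat.
Proof.
move=> x y Exy.
case: (ltnP x (n %/ c * c)) => [lt_x|ge_x]; last first.
  have ge_y : n %/ c * c <= y by rewrite leqNgt -rot_nat_lt -Exy rot_nat_lt -leqNgt.
  by move: Exy; rewrite !rot_nat_out.
have lt_y : y < n %/ c * c by rewrite -rot_nat_lt -Exy rot_nat_lt.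
have c_gt0 : 0 < c by case: c lt_x => //; rewrite muln0.
have [q ltq xq] := block_of lt_x; have [p ltp yp] := block_of lt_y.
have Eqp : q = p.
  have /andP[l1 u1] := rot_nat_block_mem ltq xq.
  have := rot_nat_block_mem ltp yp; rewrite -Exy => /andP[l2 u2].
  apply/eqP; rewrite eqn_leq -ltnS -(ltn_pmul2r c_gt0) (leq_ltn_trans l1 u2).
  by rewrite -ltnS -(ltn_pmul2r c_gt0) (leq_ltn_trans l2 u1).
move: Exy; rewrite (rot_nat_block ltq xq) (rot_nat_block ltp yp) -Eqp.
rewrite -Eqp in yp.
case/andP: xq => lex _; case/andP: yp => ley _.
case: eqP => [Ex|_]; case: eqP => [Ey|_].
- by move=> _; apply: succn_inj; rewrite Ex Ey.
- by move=> E; move: ley; rewrite E ltnn.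
- by move=> E; move: lex; rewrite -E ltnn.
- by case.
Qed.

Definition rot_ord (x : 'I_n) : 'I_n := Ordinal (rot_nat_ltn x).

Lemma rot_ord_inj : injective rot_ord.
Proof. by move=> x y [/rot_nat_inj/val_inj]. Qed.

Definition rot_intervals : {perm 'I_n} := perm rot_ord_inj.

Lemma rot_intervalsE (j : nat) (x : 'I_n) :
  1 <= j <= n %/ c -> x \in interval n c j ->
  rot_intervals x = (if x == j * c - 1 :> nat then (j - 1) * c else x.+1) :> nat.
Proof.
case: j => // q; rewrite /= inE subn1 /= => ltq /andP[lex ltx].
have c_gt0 : 0 < c by case: c ltq => //; rewrite divn0.
have qc_gt0 : 0 < q.+1 * c by rewrite muln_gt0.
rewrite permE /= (@rot_nat_block q) //.
  by rewrite -[in RHS]eqSS subn1 prednK.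
by rewrite lex -[q.+1 * c]prednK // ltnS -subn1.
Qed.

End Rotation.

(* Main.v *)
(** The sieving holds for every family X of k-subsets that is stable under the
    permutations preserving each d-interval, because it holds on each class of
    sets with prescribed d-interval counts.  Let z = w^l have order m, and write
    d = m g.  Transposing each d-interval, seen as a g x m array, conjugates the
    g-th power of the rotation of d-intervals to the rotation of m-intervals, so
    both fix equally many members of X.  In the sum of z^Sum'(A) over A in X, the
    sets fixed by the rotation of m-intervals contribute 1 each, and the others
    cancel: rotating a single m-interval that A meets in c points multiplies
    z^Sum'(A) by z^c, and z^c <> 1 when 0 < c < m. *)
Require Import Defs.
From mathcomp Require Import all_boot all_order all_algebra all_fingroup.
From mathcomp Require Import cyclic zify.

Set Implicit Arguments.
Unset Strict Implicit.
Unset Printing Implicit Defensive.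

Import GRing.Theory.

(** * Rotations of all [c]-intervals together and of a single one *)

Section Rotations.

Variables n c : nat.
Hypothesis n_gt0 : 0 < n.
Hypothesis c_dvd_n : c %| n.

Let c_gt0 : 0 < c := dvdn_gt0 n_gt0 c_dvd_n.

Lemma rot_intervals_val (x : 'I_n) :
  rot_intervals n c x = x %/ c * c + (x %% c).+1 %% c :> nat.
Proof.
have ltx : x %/ c < n %/ c by rewrite ltn_divLR // divnK.
rewrite permE /= (@rot_nat_block _ _ (x %/ c)) ?leq_divM ?ltn_ceil //.
have xE := divn_eq x c; have := ltn_pmod x c_gt0.
rewrite leq_eqVlt => /orP[/eqP Em|lt_m]; last first.
  by rewrite modn_small // ifF; [lia|apply/negP=> /eqP; lia].
by rewrite Em modnn ifT ?addn0 //; apply/eqP; lia.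
Qed.

Lemma rot_intervalsX_val (i : nat) (x : 'I_n) :
  (rot_intervals n c ^+ i)%g x = x %/ c * c + (x %% c + i) %% c :> nat.
Proof.
elim: i => [|i IHi]; first by rewrite expg0 perm1 addn0 modn_mod -divn_eq.
rewrite expgSr permM rot_intervals_val IHi.
rewrite divnMDl // modnMDl (divn_small (ltn_pmod _ c_gt0)) addn0 modn_mod.
by rewrite -addn1 modnDml addn1 addnS.
Qed.

Lemma rot_intervals_div (x : 'I_n) : rot_intervals n c x %/ c = x %/ c.
Proof.
by rewrite rot_intervals_val divnMDl // (divn_small (ltn_pmod _ c_gt0)) addn0.
Qed.

Lemma rot_intervals_mod (x : 'I_n) : rot_intervals n c x = x.+1 %[mod c].
Proof. by rewrite rot_intervals_val modnMDl modn_mod -addn1 modnDml addn1. Qed.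

Lemma order_rot_intervals : #[rot_intervals n c]%g = c.
Proof.
apply/eqP; rewrite eqn_dvd order_dvdn; apply/andP; split.
  apply/eqP/permP => x; apply: val_inj.
  by rewrite /= rot_intervalsX_val perm1 modnDr modn_mod -divn_eq.
(* The orbit of 0 detects the order: the [i]-th power sends 0 to [i %% c]. *)
have /permP/(_ (Ordinal n_gt0))/(congr1 val) := expg_order (rot_intervals n c).
by rewrite /= rot_intervalsX_val perm1 /= div0n mod0n => /eqP.
Qed.

Lemma card_block (a : nat) : #|[set x : 'I_n | x %/ c == a]| <= c.
Proof.
rewrite -[leqRHS]card_ord.
pose f (x : 'I_n) := Ordinal (ltn_pmod x c_gt0).
rewrite -(@card_in_imset _ _ f) ?max_card // => x y.
rewrite !inE => /eqP xa /eqP ya [xy]; apply: val_inj.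
by rewrite /= (divn_eq x c) (divn_eq y c) xa ya xy.
Qed.

Definition rot1_fun (a : nat) (x : 'I_n) : 'I_n :=
  if x %/ c == a then rot_intervals n c x else x.

Lemma rot1_fun_inj a : injective (rot1_fun a).
Proof.
move=> x y; rewrite /rot1_fun.
case: (eqVneq (x %/ c) a) => xa; case: (eqVneq (y %/ c) a) => ya //.
- exact: perm_inj.
- by move=> E; case/eqP: ya; rewrite -E rot_intervals_div.
- by move=> E; case/eqP: xa; rewrite E rot_intervals_div.
Qed.

Definition rot1 (a : nat) : {perm 'I_n} := perm (@rot1_fun_inj a).

Lemma rot1_div a (x : 'I_n) : rot1 a x %/ c = x %/ c.
Proof. by rewrite permE /rot1_fun; case: ifP; rewrite ?rot_intervals_div. Qed.

Lemma rot1C a x : rot_intervals n c (rot1 a x) = rot1 a (rot_intervals n c x).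
Proof.
by rewrite ![rot1 a _]permE /rot1_fun rot_intervals_div; case: ifP.
Qed.

(** Some [x] in [A] has its rotation outside [A]. The block of [x] contains both points, so it meets
    [A] without being contained in it. *)
Lemma exists_split_block (A : {set 'I_n}) : rot_intervals n c @: A != A ->
  exists a : 'I_n, 0 < #|A :&: [set x : 'I_n | x %/ c == a]| < c.
Proof.
rewrite eqEcard card_imset ?leqnn ?andbT; last exact: perm_inj.
case/subsetPn => _ /imsetP[x Ax ->] NAx.
have lta : x %/ c < n by apply: leq_ltn_trans (ltn_ord x); apply: leq_div.
exists (Ordinal lta); apply/andP; split.
  by apply/card_gt0P; exists x; rewrite !inE Ax /=.
apply: leq_trans (card_block (x %/ c)); apply: proper_card.
apply/properP; split; first exact: subsetIr.
by exists (rot_intervals n c x); rewrite !inE ?rot_intervals_div ?(negPf NAx).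
Qed.

End Rotations.

(** * Images of sets under permutations, and binomial coefficients *)

Lemma perm_imset_eq (T : finType) (s t u : {perm T}) (A : {set T}) :
  (forall x, s (u x) = u (t x)) ->
  (s @: (u @: A) == u @: A) = (t @: A == A).
Proof.
move=> sut; rewrite -imset_comp (eq_imset _ sut) (imset_comp u).
by rewrite (inj_eq (imset_inj (@perm_inj _ u))).
Qed.

Lemma card_imsetI (T : finType) (s : {perm T}) (A B : {set T}) :
  (forall x, (s x \in B) = (x \in B)) -> #|s @: A :&: B| = #|A :&: B|.
Proof.
move=> sB; rewrite -[RHS](card_imset _ (@perm_inj _ s)).
apply: eq_card => x; rewrite in_setI; apply/andP/imsetP.
  by case=> /imsetP[t At ->]; rewrite sB => Bt; exists t; rewrite // in_setI At.
by case=> t; rewrite in_setI => /andP[At Bt] ->; rewrite sB imset_f.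
Qed.

Lemma bin2D (a b : nat) : 'C(a + b, 2) = 'C(a, 2) + 'C(b, 2) + a * b.
Proof.
elim: a => [|a IHa]; first by rewrite addn0.
by rewrite addSn !binS !bin1 IHa; lia.
Qed.

(** In this form the first term cancels the residue part of the sum of a rotation-stable set, and
    the second is visibly divisible by [m]. *)
Lemma bin2M (m a : nat) : 'C(m * a, 2) = a * 'C(m, 2) + m * (m * 'C(a, 2)).
Proof.
elim: a => [|a IHa]; first by rewrite !muln0.
by rewrite mulnS bin2D IHa binS bin1; nia.
Qed.

(** Induction by removing the maximum [x]: the remaining elements are distinct and below [x], so [x]
    is at least their number. *)
Lemma bin2_le_sum (n : nat) (A : {set 'I_n}) : 'C(#|A|, 2) <= \sum_(a in A) a.
Proof.
move: {2}#|A| (erefl #|A|) => k; elim: k A => [|k IHk] A cA; first by rewrite cA.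
have /card_gt0P[x0 Ax0] : 0 < #|A| by rewrite cA.
have [x Ax x_max] := @arg_maxnP _ x0 (fun x => x \in A) val Ax0.
have cA' : #|A :\ x| = k by move: (cardsD1 x A); rewrite Ax cA => -[].
rewrite (big_setD1 x) //= cA binS bin1 addnC leq_add //; last first.
  by rewrite -cA' IHk.
rewrite -cA' -[leqRHS]card_ord.
have ltx (y : 'I_n) : y \in A :\ x -> y < x.
  by rewrite !inE ltn_neqAle => /andP[yx /x_max le_yx]; apply/andP.
have [->|[y0 Ay0]] := set_0Vmem (A :\ x); first by rewrite cards0.
have x_gt0 : 0 < x by apply: leq_ltn_trans (ltx _ Ay0).
pose f (y : 'I_n) : 'I_x := insubd (Ordinal x_gt0) (val y).
rewrite -(@card_in_imset _ _ f) ?max_card // => y z /ltx ltyx /ltx ltzx.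
by move/(congr1 val); rewrite !val_insubd ltyx ltzx => /val_inj.
Qed.

(** * [Sum'] modulo [m], on fixed sets and under a single-block rotation *)

Section FixedWeight.

Variables n m : nat.
Hypothesis n_gt0 : 0 < n.
Hypothesis m_dvd_n : m %| n.

Let m_gt0 : 0 < m := dvdn_gt0 n_gt0 m_dvd_n.

(** A fixed set has equally many elements, [K], in each residue class mod [m]. Its sum is therefore
    a multiple of [m] plus [K * 'C(m, 2)], and [bin2M] gives ['C(m * K, 2)] the same shape. *)
Lemma dvdn_Sum'_fixed (k : nat) (A : {set 'I_n}) :
  #|A| = k -> rot_intervals n m @: A = A -> m %| Sum' k A.
Proof.
move=> cA fixA.
pose key (x : 'I_n) := Ordinal (ltn_pmod x m_gt0).
pose K := #|[set x in A | x %% m == 0]|.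
(* The rotation maps the elements of [A] with residue [b] bijectively onto those with residue
   [b.+1]. *)
have cardK b : b < m -> #|[set x in A | x %% m == b]| = K.
  elim: b => [//|b IHb] ltb; rewrite -{}IHb 1?ltnW //.
  rewrite -[RHS](card_imset _ (@perm_inj _ (rot_intervals n m))).
  apply: eq_card => y; rewrite inE.
  apply/andP/imsetP => [[Ay /eqP yb]|[x]].
    move: Ay; rewrite -{1}fixA => /imsetP[x Ax yE]; exists x => //.
    rewrite inE Ax /=; move: yb; rewrite yE rot_intervals_mod // -addn1 -modnDml addn1.
    have := ltn_pmod x m_gt0; rewrite leq_eqVlt => /orP[/eqP ->|/modn_small ->].
      by rewrite modnn.
    by case=> ->.
  rewrite inE => /andP[Ax /eqP xb] ->; rewrite -[in X in X /\ _]fixA imset_f //.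
  by rewrite rot_intervals_mod // -addn1 -modnDml xb addn1 modn_small.
have sumE (G : nat -> nat) :
    \sum_(x in A) G (x %% m) = K * \sum_(0 <= b < m) G b.
  rewrite (partition_big key predT) //= big_mkord big_distrr /=.
  apply: eq_bigr => b _; rewrite (eq_bigr (fun=> G b)); last first.
    by move=> x /andP[_ /eqP <-].
  rewrite sum_nat_const -(cardK b) //; congr (_ * _).
  by apply: eq_card => x; rewrite inE.
have kE : k = m * K.
  by rewrite -cA -sum1_card (sumE (fun=> 1)) sum_nat_const_nat subn0 muln1 mulnC.
rewrite /Sum' (eq_bigr (fun x : 'I_n => x %/ m * m + x %% m)); last first.
  by move=> x _; exact: divn_eq.
rewrite big_split /= (sumE id) bin2_sum -big_distrl /= kE bin2M addnC subnDl.
by rewrite mulnC -mulnBr dvdn_mulr.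
Qed.

Local Open Scope ring_scope.

Variables (F : fieldType) (z : F).
Hypothesis z_prim : m.-primitive_root z.

(** Each point of [A] in block [a] has its residue mod [m] raised by one, even when it wraps around,
    and so contributes one factor [z]. *)
Lemma expr_sum_rot1 (a : nat) (A : {set 'I_n}) :
  z ^+ (\sum_(x in rot1 n_gt0 m_dvd_n a @: A) x) =
  z ^+ #|A :&: [set x : 'I_n | (x %/ m)%N == a]| * z ^+ (\sum_(x in A) x).
Proof.
rewrite big_imset /=; last by move=> x y _ _; apply: perm_inj.
rewrite -exprD -sum1_card.
rewrite (eq_bigl (fun x => (x \in A) && (x %/ m == a)%N)); last first.
  by move=> x; rewrite !inE.
rewrite big_mkcondr -big_split /= !expr_sum; apply: eq_bigr => x _.
rewrite permE /rot1_fun; case: ifP => _; last by rewrite add0n.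
by rewrite add1n; apply/eqP; rewrite (eq_prim_root_expr z_prim) rot_intervals_mod.
Qed.

(** The truncated subtraction becomes a division in the field, thanks to [bin2_le_sum]. *)
Lemma expr_Sum' (k : nat) (A : {set 'I_n}) : #|A| = k ->
  z ^+ Sum' k A = z ^+ (\sum_(x in A) x) / z ^+ 'C(k, 2).
Proof.
move=> cA; have /negPf z_neq0 : z != 0.
  apply: contra_eq_neq (prim_expr_order z_prim) => ->.
  by rewrite expr0n (gtn_eqF m_gt0) eq_sym oner_eq0.
by rewrite expfB_cond // z_neq0 -cA bin2_le_sum.
Qed.

End FixedWeight.

(** * Transposing each interval of length [m * g] as an array *)

Section Transposition.

Variables n m g : nat.
Hypothesis n_gt0 : 0 < n.
Hypothesis mg_dvd_n : m * g %| n.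

Let mg_gt0 : 0 < m * g := dvdn_gt0 n_gt0 mg_dvd_n.
Let m_gt0 : 0 < m. Proof. by move: mg_gt0; rewrite muln_gt0 => /andP[]. Qed.
Let g_gt0 : 0 < g. Proof. by move: mg_gt0; rewrite muln_gt0 => /andP[]. Qed.
Let m_dvd_n : m %| n := dvdn_trans (dvdn_mulr g (dvdnn m)) mg_dvd_n.

(** Inside its interval, the position [a * m + b] with [a < g] and [b < m] goes to [b * g + a]. *)
Definition transp_nat (x : nat) : nat :=
  x %/ (m * g) * (m * g) + (x %% m * g + x %/ m %% g).

Lemma transp_rem (x : nat) : x %% m * g + x %/ m %% g < m * g.
Proof. by have := ltn_pmod x m_gt0; have := ltn_pmod (x %/ m) g_gt0; nia. Qed.

Lemma transp_nat_div x : transp_nat x %/ (m * g) = x %/ (m * g).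
Proof. by rewrite /transp_nat divnMDl // (divn_small (transp_rem x)) addn0. Qed.

Lemma transp_nat_mod x : transp_nat x %% (m * g) = x %% m * g + x %/ m %% g.
Proof. by rewrite /transp_nat modnMDl (modn_small (transp_rem x)). Qed.

Lemma transp_nat_lt x : (transp_nat x < n) = (x < n).
Proof.
by rewrite -(divnK mg_dvd_n) -[LHS]ltn_divLR // -[RHS]ltn_divLR // transp_nat_div.
Qed.

Definition transp_fun (x : 'I_n) : 'I_n :=
  Ordinal (etrans (transp_nat_lt x) (ltn_ord x)).

Lemma transp_fun_inj : injective transp_fun.
Proof.
move=> x y [Exy]; apply: val_inj => /=.
have := transp_nat_div x; rewrite Exy transp_nat_div => Ed.
have := transp_nat_mod x; rewrite Exy transp_nat_mod => Em.
have Eb : x %% m = y %% m.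
  have := congr1 (divn^~ g) Em.
  by rewrite /= !divnMDl // !(divn_small (ltn_pmod _ g_gt0)) !addn0.
have Ea : x %/ m %% g = y %/ m %% g.
  by move/eqP: Em; rewrite Eb eqn_add2l => /eqP.
rewrite (divn_eq x m) (divn_eq y m) Eb (divn_eq (x %/ m) g) (divn_eq (y %/ m) g).
by rewrite Ea -!divnMA Ed.
Qed.

Definition transp : {perm 'I_n} := perm transp_fun_inj.

Lemma transp_div (x : 'I_n) : transp x %/ (m * g) = x %/ (m * g).
Proof. by rewrite permE /= transp_nat_div. Qed.

(** Rotating an [m]-interval raises [b] by one mod [m]; on the transposed position [b * g + a] this
    is adding [g] mod [m * g]. *)
Lemma transp_rot (x : 'I_n) :
  (rot_intervals n (m * g) ^+ g)%g (transp x) = transp (rot_intervals n m x).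
Proof.
apply: val_inj; rewrite /= rot_intervalsX_val // permE /= [in RHS]permE /=.
rewrite transp_nat_div transp_nat_mod [in RHS]/transp_nat !divnMA.
rewrite rot_intervals_div // rot_intervals_mod //; congr (_ + _).
have := ltn_pmod (x %/ m) g_gt0; have := ltn_pmod x m_gt0.
have -> : x.+1 = (x %% m).+1 %[mod m] by rewrite -addn1 -modnDml addn1.
rewrite leq_eqVlt => /orP[/eqP Em|ltm] lta.
  by rewrite addnAC -mulSnr Em modnn modnDl modn_small //; nia.
by rewrite addnAC -mulSnr [in RHS]modn_small // modn_small //; nia.
Qed.

End Transposition.

(** * Cyclic sieving for families stable under block-preserving permutations *)

Section BlockInvariant.

Variables (n k d : nat) (X : {set {set 'I_n}}).
Hypothesis n_gt0 : 0 < n.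
Hypothesis d_dvd_n : d %| n.
Hypothesis X_sub : X \subset ksubsets n k.
Hypothesis X_inv : forall s : {perm 'I_n}, (forall x, s x %/ d = x %/ d) ->
  forall A : {set 'I_n}, (s @: A \in X) = (A \in X).

Let d_gt0 : 0 < d := dvdn_gt0 n_gt0 d_dvd_n.

Let card_X A : A \in X -> #|A| = k.
Proof. by move/(subsetP X_sub); rewrite inE => /eqP. Qed.

Lemma card_fixed_rotX (m g : nat) : d = m * g ->
  #|[set A in X | (rot_intervals n d ^+ g)%g @: A == A]| =
  #|[set A in X | rot_intervals n m @: A == A]|.
Proof.
move=> dE; have mg_dvd_n : m * g %| n by rewrite -dE.
set u := transp n_gt0 mg_dvd_n.
have X_u (A : {set 'I_n}) : (u @: A \in X) = (A \in X).
  by apply: X_inv => x; rewrite dE transp_div.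
have imset_u_inj : injective (fun A : {set 'I_n} => u @: A).
  exact/imset_inj/perm_inj.
rewrite -[RHS](card_imset _ imset_u_inj); apply: eq_card => B.
have -> : B = u @: ((u^-1)%g @: B).
  rewrite -imset_comp (eq_imset (g := id)) ?imset_id // => x.
  by rewrite /= permKV.
rewrite mem_imset // !inE X_u dE; congr (_ && _).
by apply: perm_imset_eq => x; apply: transp_rot.
Qed.

Local Open Scope ring_scope.

Variables (F : numClosedFieldType).

Lemma sum_expr_Sum' (m : nat) (z : F) : (m %| d)%N -> m.-primitive_root z ->
  \sum_(A in X) z ^+ Sum' k A =
  #|[set A in X | rot_intervals n m @: A == A]|%:R.
Proof.
move=> m_dvd_d z_prim.
have m_dvd_n := dvdn_trans m_dvd_d d_dvd_n.
rewrite (bigID (fun A : {set 'I_n} => rot_intervals n m @: A == A)) /=.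
rewrite (eq_bigr (fun=> 1)) => [|A /andP[/card_X cA /eqP fixA]]; last first.
  by apply/eqP; rewrite -(prim_order_dvd z_prim) dvdn_Sum'_fixed.
rewrite sumr_const -[RHS]addr0; congr (_ + _).
  by congr (_ *+ _); apply: eq_card => A; rewrite inE.
pose blk (a : nat) := [set x : 'I_n | (x %/ m)%N == a].
(* Blocks are indexed by all of ['I_n] for convenience; those with index at least [n %/ m] are
   empty. *)
pose cnt (A : {set 'I_n}) : {ffun 'I_n -> 'I_n.+1} :=
  [ffun a : 'I_n => inord #|A :&: blk a|].
have cnt_val A (a : 'I_n) : cnt A a = #|A :&: blk a| :> nat.
  by rewrite ffunE inordK // ltnS -[leqRHS]card_ord max_card.
(* Grouping by block counts lets one block serve a whole class: a block split by one member [A0] is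
   split by every member, with the same count. *)
rewrite (partition_big cnt predT) //= big1 // => y _.
pose P (A : {set 'I_n}) :=
  (A \in X) && (rot_intervals n m @: A != A) && (cnt A == y).
have [A0 /andP[/andP[XA0 NfixA0] /eqP cntA0]|noA] := pickP P; last first.
  exact: big_pred0.
have [a /andP[c_gt0 lt_c]] := exists_split_block n_gt0 m_dvd_n NfixA0.
set s := rot1 n_gt0 m_dvd_n a.
have s_div (x : 'I_n) : (s x %/ m = x %/ m)%N by apply: rot1_div.
have Ps (A : {set 'I_n}) : P (s @: A) = P A.
  rewrite /P X_inv; last first.
    (* Since [m] divides [d], a permutation preserving the [m]-blocks preserves the [d]-blocks. *)
    by move=> x; rewrite -(divnK m_dvd_d) mulnC !divnMA s_div.
  rewrite (@perm_imset_eq _ _ (rot_intervals n m)); last exact: rot1C.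
  congr (_ && (_ == _)); apply/ffunP => b; apply: val_inj.
  rewrite /= !cnt_val; apply: card_imsetI => x.
  by rewrite !inE s_div.
have imset_s_bij : bijective (fun A : {set 'I_n} => s @: A).
  by apply: injF_bij; apply/imset_inj/perm_inj.
pose S := \sum_(A | P A) z ^+ Sum' k A; rewrite -[LHS]/S.
(* Reindexing by [s] multiplies every term by the same [z ^+ y a], which is not 1 because
   [0 < y a < m]; hence [S] vanishes. *)
have : S = z ^+ y a * S.
  rewrite {1}/S (reindex _ (onW_bij _ imset_s_bij)) big_distrr /=.
  apply: eq_big => // A; rewrite Ps => /andP[/andP[XA _] /eqP <-].
  have cA := card_X XA.
  rewrite !(expr_Sum' n_gt0 m_dvd_n z_prim) ?card_imset //; last exact: perm_inj.
  by rewrite cnt_val expr_sum_rot1 // mulrA.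
move/eqP; rewrite eq_sym -subr_eq0 -{2}[S]mul1r -mulrBl mulf_eq0 subr_eq0.
case/orP => [|/eqP //].
rewrite -(prim_order_dvd z_prim) -cntA0 cnt_val => /(dvdn_leq c_gt0).
by rewrite leqNgt lt_c.
Qed.

Lemma eval_stat_poly (T : finType) (stat : T -> nat) (Y : {set T}) (x : F) :
  eval_natpoly (stat_poly stat Y) x = \sum_(A in Y) x ^+ stat A.
Proof.
rewrite /eval_natpoly /stat_poly.
(* The eta-reduced form lets [rmorph_sum] see the coefficient map as a morphism. *)
change (fun m : nat => m%:R : F) with (@GRing.natmul F 1).
rewrite rmorph_sum horner_sum; apply: eq_bigr => A _.
by rewrite /= map_polyXn hornerXn.
Qed.

Lemma csp_block_invariant (w : F) : d.-primitive_root w ->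
  exhibits_csp d w ('P^*)%act (rot_intervals n d) X (stat_poly (@Sum' n k) X).
Proof.
move=> w_prim; set tau := rot_intervals n d.
have tau_ord : #[tau]%g = d by apply: order_rot_intervals.
have actE (s : {perm 'I_n}) A : ('P^*)%act A s = s @: A by [].
split=> //.
  rewrite cycle_subG; apply/astabsP => A; rewrite actE.
  by apply: X_inv => x; apply: rot_intervals_div.
move=> j; rewrite eval_stat_poly.
have [l -> ->] : exists2 l, expgz tau j = (tau ^+ l)%g & w ^ j = w ^+ l.
  case: j => [l|l]; first by exists l.
  (* This exponent and [l.+1] add up to [l.+1 * d], which kills both [tau] and [w]. *)
  exists (l.+1 * d.-1)%N => /=.
    apply/eqP; rewrite eq_sym eq_mulgV1 invgK -expgD -mulnSr prednK //.
    by rewrite -order_dvdn tau_ord dvdn_mull.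
  have wl : w ^+ (l.+1 * d.-1) * w ^+ l.+1 = 1.
    by rewrite -exprD -mulnSr prednK // mulnC exprM (prim_expr_order w_prim) expr1n.
  have w_neq0 : w ^+ l.+1 != 0.
    by apply: contra_eq_neq wl => ->; rewrite mulr0 eq_sym oner_eq0.
  by apply: (mulIf w_neq0); rewrite wl NegzE -exprnN mulVf.
pose g := gcdn l d; pose m := (d %/ g)%N.
have dE : d = (m * g)%N by rewrite divnK ?dvdn_gcdr.
rewrite (@sum_expr_Sum' m); last exact: exp_prim_root.
  rewrite -(card_fixed_rotX dE); congr (_%:R); apply: eq_card => A.
  rewrite !inE; congr (_ && _); rewrite actE -/tau.
  have fixE i : ((tau ^+ i)%g @: A == A) = ((tau ^+ i)%g \in 'C[A | 'P^*])%g.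
    by apply/eqP/astab1P.
  (* [tau ^+ l] and [tau ^+ g] generate the same subgroup, so they fix the same sets; one direction
     needs a Bezout relation making [g + u * l] a multiple of [d]. *)
  rewrite !fixE; apply/idP/idP => fixA; last first.
    by rewrite -(divnK (dvdn_gcdl l d)) mulnC expgM groupX.
  have [u _ /dvdnP[v uE]] := Bezoutr l d_gt0.
  have : (tau ^+ (g + u * l))%g \in 'C[A | 'P^*]%g.
    by rewrite uE mulnC expgM -tau_ord expg_order expg1n group1.
  by rewrite expgD groupMr // mulnC expgM groupX.
by rewrite dE dvdn_mulr.
Qed.

End BlockInvariant.

(** * Stability of the gcd classes, and the theorem *)

Section GcdSets.

Variables n k d : nat.
Hypothesis n_gt0 : 0 < n.

Lemma ksubsets_perm (s : {perm 'I_n}) (A : {set 'I_n}) :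
  (s @: A \in ksubsets n k) = (A \in ksubsets n k).
Proof. by rewrite !inE card_imset //; apply: perm_inj. Qed.

Lemma in_interval (c j : nat) (x : 'I_n) : 0 < c -> 0 < j ->
  (x \in Defs.interval n c j) = (x %/ c == j.-1).
Proof.
case: j => // q c_gt0 _; rewrite inE subn1 /=.
rewrite eqn_leq -[x %/ c <= q]ltnS ltn_divLR // leq_divRL // andbC; congr (_ && _).
by rewrite subn1 -ltnS prednK // muln_gt0.
Qed.

(** As [d] divides [c], every [c]-interval is a union of [d]-intervals; hence [s] preserves it and
    leaves its count unchanged. *)
Lemma Gset_perm (c f : nat) (s : {perm 'I_n}) (A : {set 'I_n}) :
  c %| n -> d %| c -> (forall x, s x %/ d = x %/ d) ->
  (s @: A \in Gset n k c f) = (A \in Gset n k c f).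
Proof.
move=> c_dvd_n d_dvd_c s_div; have c_gt0 := dvdn_gt0 n_gt0 c_dvd_n.
rewrite [LHS]in_set [RHS]in_set ksubsets_perm; congr (_ && (gcdn _ _ == _)).
apply: eq_big_nat => j /andP[j_gt0 _].
apply: card_imsetI => x.
by rewrite !in_interval // -(divnK d_dvd_c) mulnC !divnMA s_div.
Qed.

End GcdSets.

Theorem theorem7p11 (n k r : nat) (e : nat -> nat)
    (F : numClosedFieldType) (w : F)
    (n_ge1 : (1 <= n)%N) (r_ge1 : (1 <= r)%N)
    (e_dvd : forall i : nat, (i < r)%N -> (e i %| e i.+1)%N)
    (e_last : e r = n) (e_gcd : e (r - 1)%N = gcdn n k)
    (w_prim : ((e 1%N).-primitive_root w)%R) :
  let d := e 1%N in
  let GD : {set {set 'I_n}} := \bigcap_(i < r) Gset n k (e i.+1) (e i) in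
  exhibits_csp d w ('P^*)%act (rot_intervals n d) GD
    (stat_poly (@Sum' n k) GD)
  /\ refines_csp d w ('P^*)%act (rot_intervals n d) (@Sum' n k)
       GD (ksubsets n k).
Proof.
move=> d GD.
have e_dvd_up i j : i <= j -> j <= r -> e i %| e j.
  elim: j => [|j IHj]; first by rewrite leqn0 => /eqP ->.
  rewrite leq_eqVlt => /orP[/eqP -> //|le_ij] lt_jr.
  by apply: dvdn_trans (e_dvd j lt_jr); apply: IHj => //; apply: ltnW.
have d_dvd_n : d %| n by rewrite -e_last e_dvd_up.
have GD_sub : GD \subset ksubsets n k.
  apply/subsetP => A /bigcapP/(_ (Ordinal r_ge1) isT).
  by rewrite inE => /andP[].
have cspGD : exhibits_csp d w ('P^*)%act (rot_intervals n d) GD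
    (stat_poly (@Sum' n k) GD).
  apply: csp_block_invariant => // s s_div A.
  have G_perm (i : 'I_r) : (s @: A \in Gset n k (e i.+1) (e i)) =
      (A \in Gset n k (e i.+1) (e i)).
    (* Only the upper indices [i.+1], all at least 1, need to be multiples of [d = e 1]; [e 0]
       occurs only as a gcd value. *)
    by apply: (@Gset_perm _ _ d) => //; rewrite -?e_last e_dvd_up.
  by apply/bigcapP/bigcapP => GA i _; have := GA i isT; rewrite G_perm.
split=> //; split=> //.
by apply: csp_block_invariant => // s _ A; apply: ksubsets_perm.
Qed.
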